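(* Let $d\ge1$. For every $\varepsilon>0$, $$N_{\mathrm{KL}}(\Delta_{d-1},\varepsilon)\le N_{\mathrm H^2}\left(\Delta_{d-1},\frac{\varepsilon}{70}\right)\cdot 2^{8d}.$$ In particular, for every $0<\varepsilon\le1$, $$N_{\mathrm{KL}}(\Delta_{d-1},\varepsilon)\le\left(\frac{5040\cdot 2^{32}}{\varepsilon}\right)^{\frac{d-1}{2}}.$$
   Context: $\Delta_{d-1}=\{p\in\mathbb R_+^d:\sum_{i=1}^dp_i=1\}$ is the probability simplex. For $p,q\in\Delta_{d-1}$: $\mathrm{KL}(p,q)=\sum_{i}p_i\log(p_i/q_i)\in[0,+\infty]$ (with $0\log(0/\cdot)=0$ and value $+\infty$ if some $p_i>0=q_i$; natural logarithm), and $\mathrm H^2(p,q)=\frac12\sum_i(\sqrt{p_i}-\sqrt{q_i})^2$. The KL covering number is $$N_{\mathrm{KL}}(\Delta_{d-1},\varepsilon)=\min\Big\{N:\ \exists\,q^{(1)},\dots,q^{(N)}\in\Delta_{d-1}\text{ such that }\sup_{p\in\Delta_{d-1}}\min_{1\le k\le N}\mathrm{KL}(p,q^{(k)})\le\varepsilon\Big\}.$$ $N_{\mathrm H^2}(\Delta_{d-1},r)$ is the covering number in squared Hellinger distance at scale $r$: the smallest $N$ for which there exist $q^{(1)},\dots,q^{(N)}\in\Delta_{d-1}$ such that every $p\in\Delta_{d-1}$ satisfies $\mathrm H^2(p,q^{(k)})\le r$ for some $k$. *)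

(* Defs.v *)
From mathcomp Require Import all_boot all_order all_algebra.
From mathcomp Require Import all_classical all_reals all_analysis.

Set Implicit Arguments.
Unset Strict Implicit.
Unset Printing Implicit Defensive.

Import Order.TTheory GRing.Theory Num.Theory.

Local Open Scope classical_set_scope.
Local Open Scope ring_scope.

Definition simplex (R : realType) (d : nat) : set 'rV[R]_d :=
  [set p | (forall i, 0 <= p ord0 i) /\ \sum_(i < d) p ord0 i = 1].

Definition KL_term (R : realType) (a b : R) : \bar R :=
  if a == 0 then 0%E else if b == 0 then +oo%E else (a * ln (a / b))%:E.

Definition KL (R : realType) (d : nat) (p q : 'rV[R]_d) : \bar R :=
  (\sum_(i < d) KL_term (p ord0 i) (q ord0 i))%E.

Definition hellinger2 (R : realType) (d : nat) (p q : 'rV[R]_d) : R :=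
  2^-1 * \sum_(i < d) (Num.sqrt (p ord0 i) - Num.sqrt (q ord0 i)) ^+ 2.

(* The minimum over an empty family of centers is +oo. *)
Definition KL_cover (R : realType) (d : nat) (eps : R) (N : nat)
    (q : 'I_N -> 'rV[R]_d) : Prop :=
  (forall k, simplex (q k)) /\
  (ereal_sup [set \big[Order.min/+oo]_(k < N) KL p (q k)
               | p in @simplex R d] <= eps%:E)%E.

Definition hellinger2_cover (R : realType) (d : nat) (r : R) (N : nat)
    (q : 'I_N -> 'rV[R]_d) : Prop :=
  (forall k, simplex (q k)) /\
  forall p, simplex p -> exists k, hellinger2 p (q k) <= r.

(* Covering numbers take values in \bar R: the infimum of a nonempty set of
   naturals is its minimum, and it is +oo when no finite cover exists. *)
Definition N_KL (R : realType) (d : nat) (eps : R) : \bar R :=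
  ereal_inf [set (N%:R : R)%:E
              | N in [set N | exists q : 'I_N -> 'rV[R]_d, KL_cover eps q]].

Definition N_H2 (R : realType) (d : nat) (r : R) : \bar R :=
  ereal_inf [set (N%:R : R)%:E
              | N in [set N | exists q : 'I_N -> 'rV[R]_d,
                                hellinger2_cover r q]].

(* Main.v *)
(* On the square-root scale KL is locally quadratic: for positive u,
   KL(p, u / sum u) <= sum (p_i - u_i)^2 / u_i, and if sqrt u_i is at least
   sqrt p_i and exceeds it by at most h then each term is at most 4 h^2.  So
   rounding sqrt p up to a grid of side h ~ sqrt (eps / d) yields centers at KL
   distance at most eps.

   Inside a Hellinger ball of squared radius eps / 70 the displacement measured
   in grid cells has l2 norm at most sqrt (4 d / 35), hence l1 norm at most d by
   Cauchy-Schwarz, which leaves at most 2^d * C(2d, d) <= 2^(3d) grid cells.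

   The second bound does not go through the Hellinger covering number: the same
   grid on the whole simplex has l1 size O(d / sqrt eps), so counting d - 1
   coordinates gives C(O(d / sqrt eps), d - 1) = O(1 / sqrt eps)^(d - 1). *)
Require Import Defs.
From mathcomp Require Import all_boot all_order all_algebra.
From mathcomp Require Import all_classical all_reals all_analysis.
From mathcomp Require Import ring lra zify.

Import Order.TTheory GRing.Theory Num.Theory.

Local Open Scope classical_set_scope.
Local Open Scope ring_scope.

(** * Normalized centers and the quadratic bound on KL *)

Definition normalize {R : realType} {d : nat} (u : 'I_d -> R) : 'rV[R]_d :=
  \row_i (u i / \sum_j u j).

Lemma simplex_normalize (R : realType) (d : nat) (u : 'I_d -> R) :
  (0 < d)%N -> (forall i, 0 < u i) ->
  simplex (normalize u).
Proof.
move=> d_gt0 u_gt0.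
have Z_gt0 : 0 < \sum_j u j.
  rewrite (bigD1 (Ordinal d_gt0)) //= ltr_pwDl //.
  by apply: sumr_ge0 => i _; exact: ltW.
split=> [i|]; first by rewrite mxE divr_ge0 ?ltW.
rewrite (eq_bigr (fun i => u i / \sum_j u j)); last by move=> i _; rewrite mxE.
by rewrite -mulr_suml divff ?gt_eqF.
Qed.

(* Both logarithms, of p_i / u_i and of the normalizing constant, are bounded by
   ln t <= t - 1; the first-order terms then cancel. *)
Lemma KL_normalize_le (R : realType) (d : nat) (p : 'rV[R]_d) (u : 'I_d -> R) :
  simplex p -> (forall i, 0 < u i) ->
  (KL p (normalize u) <= (\sum_i (p ord0 i - u i) ^+ 2 / u i)%:E)%E.
Proof.
move=> [p_ge0 p_sum] u_gt0.
have d_gt0 : (0 < d)%N.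
  by case: d p u {p_ge0 u_gt0} p_sum => // p _ /eqP; rewrite big_ord0 eq_sym oner_eq0.
have Z_gt0 : 0 < \sum_j u j.
  rewrite (bigD1 (Ordinal d_gt0)) //= ltr_pwDl //.
  by apply: sumr_ge0 => i _; exact: ltW.
set Z := \sum_j u j in Z_gt0 *.
have ln_le t : 0 < t -> ln t <= t - 1 :> R.
  by move=> t_gt0; have := @le_ln1Dx R (t - 1); rewrite subrKC; apply; lra.
have term_le i : (KL_term (p ord0 i) (normalize u ord0 i) <=
    (p ord0 i ^+ 2 / u i - p ord0 i + p ord0 i * (Z - 1))%:E)%E.
  rewrite /KL_term; case: eqP => [->|/eqP p_neq0].
    by rewrite expr0n /= !mul0r subr0 addr0.
  rewrite mxE -/Z gt_eqF ?divr_gt0 // lee_fin.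
  have p_gt0 : 0 < p ord0 i by rewrite lt_neqAle eq_sym p_neq0 p_ge0.
  have u_i := u_gt0 i.
  have -> : p ord0 i / (u i / Z) = p ord0 i / u i * Z.
    by field; rewrite !gt_eqF.
  rewrite lnM ?posrE ?divr_gt0 //.
  have lnZ_le := ler_wpM2l (ltW p_gt0) (ln_le _ Z_gt0).
  have lnp_le := ler_wpM2l (ltW p_gt0) (ln_le _ (divr_gt0 p_gt0 u_i)).
  have -> : p ord0 i ^+ 2 / u i = p ord0 i * (p ord0 i / u i) by ring.
  by rewrite mulrDr; lra.
apply: le_trans; first by apply: lee_sum => i _; exact: term_le.
rewrite sumEFin lee_fin !big_split /= -mulr_suml p_sum.
rewrite [leRHS](eq_bigr (fun i => p ord0 i ^+ 2 / u i - p ord0 i *+ 2 + u i)).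
  rewrite !big_split /= !sumrN sumrMnl -/Z p_sum.
  by lra.
by move=> i _; field; rewrite gt_eqF.
Qed.

(** * Rounding inequalities and the counting of grid cells *)

Lemma N_KL_le_card (R : realType) (d : nat) (eps : R) (T : finType)
    (A : {set T}) (c : T -> 'rV[R]_d) :
  (forall t, t \in A -> simplex (c t)) ->
  (forall p, simplex p -> exists2 t, t \in A & (KL p (c t) <= eps%:E)%E) ->
  (N_KL d eps <= (#|A|%:R)%:E)%E.
Proof.
move=> cS cov; apply: ereal_inf_lbound; exists #|A| => //.
exists (fun k => c (enum_val k)); split=> [k|]; first exact/cS/enum_valP.
apply: ge_ereal_sup => _ [p /cov [t tA le_eps] <-].
apply: (bigmin_inf (enum_rank_in tA t)) => //.
by rewrite enum_rankK_in.
Qed.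

(** Rounding upward matters: [x <= u] gives [x + u <= 2 * u], which cancels the denominator. *)
Lemma sqr_cell_le (R : realType) (x u h : R) : 0 <= x <= u -> 0 < u ->
  u - x <= h -> (x ^+ 2 - u ^+ 2) ^+ 2 / u ^+ 2 <= 4 * h ^+ 2.
Proof.
move=> /andP[x_ge0 x_le] u_gt0 u_x.
rewrite ler_pdivrMr ?exprn_gt0 //.
have -> : (x ^+ 2 - u ^+ 2) ^+ 2 = (u - x) ^+ 2 * (x + u) ^+ 2 by ring.
have -> : 4 * h ^+ 2 * u ^+ 2 = h ^+ 2 * (2 * u) ^+ 2 by ring.
by apply: ler_pM; rewrite ?sqr_ge0 //; apply: lerXn2r; rewrite ?nnegrE; lra.
Qed.

(** Cauchy-Schwarz in the form [2 * c * a i <= a i ^+ 2 + c ^+ 2], summed over [i]. *)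
Lemma sum_le_of_sum_sqr (R : realType) (n : nat) (a : 'I_n -> R) (c : R) :
  0 < c -> \sum_i a i ^+ 2 <= n%:R * c ^+ 2 -> \sum_i a i <= n%:R * c.
Proof.
move=> c_gt0 le_sqr; rewrite -(ler_pM2l c_gt0) mulr_sumr.
have : \sum_i c * a i <= \sum_i (a i ^+ 2 / 2 + c ^+ 2 / 2).
  by apply: ler_sum => i _; have := sqr_ge0 (a i - c); rewrite sqrrB; lra.
rewrite big_split /= -mulr_suml sumr_const card_ord -mulr_natl => /le_trans.
by apply; lra.
Qed.

Lemma bin_le_exp2 (N m : nat) : ('C(N, m) <= 2 ^ N)%N.
Proof.
case: (leqP m N) => [le_mN|lt]; last by rewrite bin_small.
rewrite -(card_ord N) -cardsT -card_powerset -(cards_draws [set: 'I_N]%SET m).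
by apply/subset_leq_card/fintype.subsetP => B; rewrite !inE => /andP[].
Qed.

(** One term of the binomial expansion gives C(N, m) x^m <= (1 + x)^N <= e^(xN) <= e^m <= 4^m. *)
Lemma bin_le_expr (R : realType) (N m : nat) (x : R) : 0 < x ->
  x * N%:R <= m%:R -> 'C(N, m)%:R <= (4 / x) ^+ m.
Proof.
move=> x_gt0 xN.
case: (leqP m N) => [le_mN|lt]; last first.
  by rewrite bin_small // exprn_ge0 // divr_ge0 ?ltW.
rewrite expr_div_n ler_pdivlMr ?exprn_gt0 // mulr_natl.
have bin_le : x ^+ m *+ 'C(N, m) <= (1 + x) ^+ N.
  rewrite exprDn (bigD1 (inord m)) //= inordK // expr1n mul1r lerDl.
  apply: sumr_ge0 => i _; rewrite expr1n mul1r mulrn_wge0 //.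
  by rewrite exprn_ge0 // ltW.
apply: (le_trans bin_le).
have expR1_le4 : expR 1 <= 4 :> R.
  have := @expR_ge1Dx R (- 2^-1); rewrite expRN => e_ge.
  have e_le : expR (2^-1 : R) <= 2.
    rewrite -[expR _]invrK -[leRHS]invrK lef_pV2 ?posrE ?invr_gt0 ?expR_gt0 //.
    by lra.
  have -> : 4 = 2 * 2 :> R by ring.
  have -> : expR 1 = expR 2^-1 * expR 2^-1 :> R.
    by rewrite -expRD; congr expR; lra.
  by apply: ler_pM; rewrite ?expR_ge0.
apply: (@le_trans _ _ (expR x ^+ N)).
  by apply: lerXn2r; rewrite ?nnegrE ?expR_ge0 ?expR_ge1Dx //; lra.
rewrite -expRM_natr; apply: (@le_trans _ _ (expR m%:R)).
  by rewrite ler_expR.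
rewrite -[m%:R]mul1r expRM_natr.
by apply: lerXn2r; rewrite ?nnegrE ?expR_ge0.
Qed.

(** The strict bound by [L.+1] forces the integer parts to sum to at most [L]; there are C(n + L, n)
    such tuples. *)
Lemma floor_tuple (R : realType) (n L : nat) (a : 'I_n -> R) :
  (forall i, 0 <= a i) -> \sum_i a i < L.+1%:R ->
  exists2 t : n.-tuple 'I_L.+1,
    t \in [set t : n.-tuple 'I_L.+1 | (\sum_(i <- t) i <= L)%N]%SET &
    forall i, (tnth t i)%:R <= a i < (tnth t i).+1%:R.
Proof.
move=> a_ge0 a_lt.
have k_itv i := truncn_itv (a_ge0 i).
have k_sum : (\sum_i Num.truncn (a i) <= L)%N.
  rewrite -ltnS -(ltr_nat R) natr_sum; apply: le_lt_trans a_lt.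
  by apply: ler_sum => i _; case/andP: (k_itv i).
have k_le i : (Num.truncn (a i) < L.+1)%N.
  by rewrite ltnS (leq_trans _ k_sum) // (bigD1 i) //= leq_addr.
exists [tuple Ordinal (k_le i) | i < n]; last first.
  by move=> i; rewrite tnth_mktuple; exact: k_itv.
rewrite inE big_tuple (eq_bigr (fun i => Num.truncn (a i))) // => i _.
by rewrite tnth_mktuple.
Qed.

(** * Refining a Hellinger cover into a KL cover *)

Lemma N_KL_le_hellinger2_cover (R : realType) (d : nat) (eps : R) (N : nat)
    (q : 'I_N -> 'rV[R]_d) : (0 < d)%N -> 0 < eps ->
  hellinger2_cover (eps / 70) q ->
  (N_KL d eps <= ((N * 2 ^ (8 * d))%:R)%:E)%E.
Proof.
move=> d_gt0 eps_gt0 [_ q_cover].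
have dR_gt0 : 0 < d%:R :> R by rewrite ltr0n.
(* With this side, [d] terms of size [4 * h ^+ 2] add up to exactly [eps]. *)
pose h : R := Num.sqrt (eps / (4 * d%:R)).
have h2E : h ^+ 2 = eps / (4 * d%:R).
  by rewrite sqr_sqrtr // divr_ge0 ?mulr_ge0 ?ler0n // ltW.
have h_gt0 : 0 < h by rewrite sqrtr_gt0 divr_gt0 // mulr_gt0.
(* q_k is fixed, s records the signs of sqrt p - sqrt q_k and t its absolute
   value in units of h, rounded down; the center is the upper end of the cell. *)
pose u k (s : {set 'I_d}) (t : d.-tuple 'I_d.+1) i : R :=
  let y := Num.sqrt (q k ord0 i) in
  if i \in s then y + h *+ (tnth t i).+1 else Num.max h (y - h *+ tnth t i).
have u_gt0 k s t i : 0 < u k s t i.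
  rewrite /u; case: ifP => _; last by rewrite lt_max h_gt0.
  by rewrite ltr_wpDl ?sqrtr_ge0 // pmulrn_lgt0.
pose A : {set d.-tuple 'I_d.+1} :=
  [set t : d.-tuple 'I_d.+1 | (\sum_(i <- t) i <= d)%N]%SET.
pose c (x : 'I_N * {set 'I_d} * d.-tuple 'I_d.+1) : 'rV[R]_d :=
  normalize (fun i => u x.1.1 x.1.2 x.2 i ^+ 2).
have := @N_KL_le_card R d eps _ (finset.setX finset.setT A) c.
rewrite finset.cardsX cardsT card_prod card_ord card_partial_ord_partitions.
have -> : #|{: {set 'I_d}}| = (2 ^ d)%N.
  by rewrite -cardsT -powersetT card_powerset cardsT card_ord.
move=> N_KL_le; apply: (le_trans (N_KL_le _ _)).
- by move=> x _; apply: simplex_normalize => // i; rewrite exprn_gt0.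
- move=> p pS; have [k] := q_cover _ pS.
  have [p_ge0 _] := pS.
  rewrite /hellinger2 => hell.
  pose e i := Num.sqrt (p ord0 i) - Num.sqrt (q k ord0 i).
  have [||t tA tP] := @floor_tuple R d d (fun i => `|e i| / h).
    by move=> i; rewrite divr_ge0 // ltW.
    (* [hell] bounds the sum of the [e i ^+ 2] by eps / 35, within the eps / 4 = d h^2 required. *)
    apply: (@le_lt_trans _ _ (d%:R * 1)); last by rewrite mulr1 ltr_nat.
    apply: sum_le_of_sum_sqr => //.
    under eq_bigr => i _ do rewrite expr_div_n real_normK ?num_real //.
    rewrite -mulr_suml ler_pdivrMr ?exprn_gt0 // h2E expr1n mulr1.
    have -> : d%:R * (eps / (4 * d%:R)) = eps / 4 by field; rewrite gt_eqF.
    by rewrite /e; lra.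
  exists (k, [set i | 0 <= e i]%SET, t).
    by rewrite inE /= tA andbT inE.
  apply: le_trans (KL_normalize_le _ _ _ _ pS _) _.
    by move=> i; rewrite exprn_gt0.
  rewrite lee_fin.
  apply: (@le_trans _ _ (\sum_(i < d) 4 * h ^+ 2)); last first.
    rewrite sumr_const card_ord -mulr_natl h2E le_eqVlt; apply/orP; left.
    by apply/eqP; field; rewrite gt_eqF.
  apply: ler_sum => i _ /=.
  rewrite -[X in (X - _) ^+ 2](sqr_sqrtr (p_ge0 i)).
  have /andP[lo hi] : h *+ tnth t i <= `|e i| < h *+ (tnth t i).+1.
    by rewrite -!(mulr_natl h) -ler_pdivlMr // -ltr_pdivrMr.
  rewrite mulrS in hi.
  have x_ge0 : 0 <= Num.sqrt (p ord0 i) := sqrtr_ge0 _.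
  have := u_gt0 k [set i | 0 <= e i]%SET t i.
  have e_iE : e i = Num.sqrt (p ord0 i) - Num.sqrt (q k ord0 i) by [].
  rewrite /u inE [h *+ _.+1]mulrS.
  case: (ger0P (e i)) lo hi => e_i lo hi u_i; apply: sqr_cell_le => //.
  + by apply/andP; split=> //; lra.
  + by lra.
  + by rewrite x_ge0 le_max; apply/orP; right; lra.
  (* The lower cutoff [h], which keeps [u] positive, exceeds sqrt p_i >= 0 by at most [h]. *)
  + by rewrite lerBlDr ge_max; apply/andP; split; lra.
rewrite lee_fin ler_nat -mulnA leq_mul2l; apply/orP; right.
(* 2^d sign patterns and C(2d, d) <= 2^(2d) tuples; the factor 2^(5d) is slack. *)
have -> : (8 * d = d + (d + d) + 5 * d)%N by lia.
rewrite (expnD 2 (d + (d + d))) (expnD 2 d).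
by rewrite -[X in (X <= _)%N]muln1 !leq_mul ?bin_le_exp2 ?expn_gt0.
Qed.

(** * Direct grid on the whole simplex *)

Lemma simplex_coord_ge (R : realType) (d : nat) (p : 'rV[R]_d) :
  (0 < d)%N -> simplex p -> exists j, d%:R^-1 <= p ord0 j.
Proof.
move=> d_gt0 [_ p_sum]; apply/existsP; apply: contraPT (p_sum).
rewrite negb_exists => /forallP p_lt; apply/eqP; rewrite lt_eqF //.
apply: (@lt_le_trans _ _ (\sum_(j < d) d%:R^-1)).
  apply: ltr_sum => [|j _]; last by rewrite ltNge.
  by apply/hasP; exists (Ordinal d_gt0); rewrite ?mem_index_enum.
by rewrite sumr_const card_ord -[_ *+ d]mulr_natl divff // pnatr_eq0 -lt0n.
Qed.

(* All coordinates but the j-th, with p_j >= 1/d, are rounded up on the grid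
   h * k of square roots.  They determine p_j up to O(d * h), so that locating it
   with precision 2 * h takes only 2 * d values of t: this saves one dimension. *)
Lemma N_KL_le_simplex_grid (R : realType) (m : nat) (eps : R) :
  (0 < m)%N -> 0 < eps <= 1 ->
  (N_KL m.+1 eps <= ((160 / Num.sqrt eps) ^+ m)%:E)%E.
Proof.
move=> m_gt0 /andP[eps_gt0 eps_le1].
set d := m.+1.
have dR_gt0 : 0 < d%:R :> R by rewrite ltr0n.
have mR_ge1 : 1 <= m%:R :> R by rewrite ler1n.
have dRE : d%:R = m%:R + 1 :> R by rewrite /d -natr1.
pose s := Num.sqrt eps.
have s2E : s ^+ 2 = eps by rewrite sqr_sqrtr // ltW.
have s_gt0 : 0 < s by rewrite sqrtr_gt0.
have s_le1 : s <= 1 by rewrite -sqrtr1 ler_sqrt.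
(* Half of [eps] goes to the [m] rounded coordinates, at most 4 h^2 each, and half to p_j, where the
   term is at most (2h)^2 / (1/d). *)
pose h : R := Num.sqrt (eps / (8 * d%:R)).
have h2E : h ^+ 2 = eps / (8 * d%:R).
  by rewrite sqr_sqrtr // divr_ge0 ?mulr_ge0 ?ler0n // ltW.
have h_gt0 : 0 < h by rewrite sqrtr_gt0 divr_gt0 // mulr_gt0.
have h_le1 : h <= 1.
  by rewrite -sqrtr1 ler_sqrt // ler_pdivrMr ?mulr_gt0 //; lra.
(* The sum of the (x_i / h)^2 is at most 8d / eps <= m (4 / s)^2, as d <= 2m. *)
pose L := Num.truncn (m%:R * (4 / s)).
have L_itv : L%:R <= m%:R * (4 / s) < L.+1%:R.
  by rewrite truncn_itv // mulr_ge0 // divr_ge0 // ltW.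
pose A : {set m.-tuple 'I_L.+1} :=
  [set k : m.-tuple 'I_L.+1 | (\sum_(i <- k) i <= L)%N]%SET.
pose v (k : m.-tuple 'I_L.+1) i : R := h *+ (tnth k i).+1.
have v_gt0 k i : 0 < v k i by rewrite /v pmulrn_lgt0.
(* As the [v k i] round up, 1 - sum v^2 is at most p_j, so only upward steps are needed. The cutoff
   1/d <= p_j bounds the divisor from below. *)
pose w k (t : nat) : R :=
  Num.max d%:R^-1 (1 - \sum_i v k i ^+ 2 + (2 * h) *+ t.+1).
have w_gt0 k t : 0 < w k t by rewrite lt_max invr_gt0 dR_gt0.
pose u (j : 'I_d) (t : nat) k (i : 'I_d) : R :=
  if unlift j i is Some i' then v k i' ^+ 2 else w k t.
have u_gt0 (j : 'I_d) t k i : 0 < u j t k i.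
  by rewrite /u; case: unlift => [i'|]; rewrite ?exprn_gt0.
pose c (x : 'I_d * 'I_(2 * d) * m.-tuple 'I_L.+1) : 'rV[R]_d :=
  normalize (u x.1.1 x.1.2 x.2).
have := @N_KL_le_card R d eps _ (finset.setX finset.setT A) c.
rewrite finset.cardsX cardsT card_prod !card_ord card_partial_ord_partitions.
move=> N_KL_le; apply: (le_trans (N_KL_le _ _)).
- by move=> x _; apply: simplex_normalize.
- move=> p pS; have [j p_j] := @simplex_coord_ge R d p isT pS.
  have [p_ge0 p_sum] := pS.
  rewrite (bigD1_ord j) //= in p_sum.
  pose x i := Num.sqrt (p ord0 (lift j i)).
  have x_ge0 i : 0 <= x i by exact: sqrtr_ge0.
  have x2E i : x i ^+ 2 = p ord0 (lift j i) by rewrite sqr_sqrtr.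
  have x2_sum : \sum_i x i ^+ 2 = 1 - p ord0 j.
    by rewrite (eq_bigr _ (fun i _ => x2E i)) -p_sum; ring.
  have x_le1 i : x i <= 1.
    rewrite -(@expr_le1 _ 2) // (@le_trans _ _ (1 - p ord0 j)) //.
      rewrite -x2_sum (bigD1 i) //= lerDl.
      by apply: sumr_ge0 => ? _; exact: sqr_ge0.
    by have := p_ge0 j; lra.
  have [||k kA kP] := @floor_tuple R m L (fun i => x i / h).
    by move=> i; rewrite divr_ge0 // ltW.
    case/andP: L_itv => _; apply: le_lt_trans.
    apply: sum_le_of_sum_sqr; first by rewrite divr_gt0.
    under eq_bigr => i _ do rewrite expr_div_n.
    rewrite -mulr_suml x2_sum h2E expr_div_n s2E.
    rewrite ler_pdivrMr ?divr_gt0 ?mulr_gt0 //.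
    have -> : m%:R * (4 ^+ 2 / eps) * (eps / (8 * d%:R)) = 2 * m%:R / d%:R.
      by field; rewrite !gt_eqF.
    rewrite (@le_trans _ _ 1) //; first by have := p_ge0 j; lra.
    by rewrite ler_pdivlMr //; lra.
  have xv i : x i <= v k i <= x i + h.
    have := kP i; rewrite ler_pdivlMr // ltr_pdivrMr // !mulr_natl /v mulrS.
    by lra.
  (* Each v^2 - x^2 = (v - x)(v + x) is at most h * 3, since x and h are at most 1. *)
  have gap : 0 <= p ord0 j - (1 - \sum_i v k i ^+ 2) <= m%:R * (3 * h).
    have -> : p ord0 j - (1 - \sum_i v k i ^+ 2) =
        \sum_i (v k i ^+ 2 - x i ^+ 2) by rewrite sumrB x2_sum; lra.
    apply/andP; split.
      apply: sumr_ge0 => i _; rewrite subr_ge0.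
      by case/andP: (xv i) => xv1 xv2; apply: lerXn2r; rewrite ?nnegrE // ltW.
    rewrite mulr_natl -[m in _ *+ m]card_ord -sumr_const.
    apply: ler_sum => i _.
    case/andP: (xv i) => xv1 xv2.
    rewrite subr_sqr [3 * h]mulrC.
    by apply: ler_pM; have := x_le1 i; have := x_ge0 i; lra.
  have g_gt0 : 0 < 2 * h by rewrite mulr_gt0.
  case/andP: gap => gap_ge0 gap_le.
  have := truncn_itv (divr_ge0 gap_ge0 (ltW g_gt0)).
  set t := Num.truncn _; rewrite ler_pdivlMr // ltr_pdivrMr //.
  rewrite !(mulr_natl (2 * h)).
  case/andP=> t_le t_lt.
  have t_ub : (t < 2 * d)%N.
    rewrite -(ltr_nat R) -(ltr_pM2r g_gt0) (mulr_natl (2 * h)) natrM dRE.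
    by apply: le_lt_trans t_le _; nra.
  exists (j, Ordinal t_ub, k); first by rewrite inE /= kA andbT inE.
  apply: le_trans (KL_normalize_le _ _ _ _ pS _) _ => //.
  rewrite lee_fin (bigD1_ord j) //=.
  have -> : eps = eps / 2 + eps / 2 by lra.
  apply: lerD.
    rewrite /u unlift_none ler_pdivrMr //.
    have w_ge : d%:R^-1 <= w k t by rewrite le_max lexx.
    have w_lo : p ord0 j <= w k t by rewrite le_max; apply/orP; right; lra.
    have w_hi : w k t <= p ord0 j + 2 * h.
      by rewrite ge_max; rewrite [2 * h *+ _.+1]mulrS; apply/andP; split; lra.
    apply: (@le_trans _ _ (eps / 2 * d%:R^-1)); last first.
      by rewrite ler_pM2l ?divr_gt0.
    have -> : eps / 2 / d%:R = (2 * h) ^+ 2.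
      by rewrite exprMn h2E; field; rewrite gt_eqF.
    rewrite -sqrrN opprB; apply: lerXn2r; rewrite ?nnegrE; lra.
  apply: (@le_trans _ _ (\sum_(i < m) 4 * h ^+ 2)).
    apply: ler_sum => i _; rewrite /u liftK -x2E.
    by case/andP: (xv i) => xv1 xv2; apply: sqr_cell_le; rewrite ?x_ge0 //; lra.
  rewrite sumr_const card_ord -(mulr_natl _ m) h2E.
  have -> : m%:R * (4 * (eps / (8 * d%:R))) = eps / 2 * (m%:R / d%:R).
    by field; rewrite gt_eqF.
  apply: ler_piMr; first by rewrite divr_ge0 // ltW.
  by rewrite ler_pdivrMr //; lra.
rewrite lee_fin natrM.
(* The factor 8^m absorbs the 2d^2 choices of [(j, t)]; the rest is [bin_le_expr] at s / 5, as s (m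
   + L) <= 5m. *)
have -> : 160 / s = 8 * (4 / (s / 5)) by field; rewrite gt_eqF.
rewrite exprMn; apply: ler_pM; rewrite ?ler0n //.
  rewrite -[8]/(8%:R) -natrX ler_nat mulnCA.
  have m_lt : (d <= 2 ^ m)%N by exact: ltn_expl.
  rewrite (_ : 8 = 2 * (2 * 2))%N // !expnMn.
  apply: leq_mul; last exact: leq_mul.
  by rewrite -[X in (X <= _)%N]expn1 leq_exp2l.
apply: bin_le_expr; first by rewrite divr_gt0.
rewrite natrD.
case/andP: L_itv => L_le _.
have : s * L%:R <= m%:R * 4.
  rewrite -[leRHS](_ : s * (m%:R * (4 / s)) = _) ?ler_pM2l //.
  by field; rewrite gt_eqF.
by nra.
Qed.

(** * Passage to covering numbers and final constants *)

Theorem proposition2 (R : realType) (d : nat) (hd : (1 <= d)%N) :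
  (forall eps : R, 0 < eps ->
     (N_KL d eps <= N_H2 d (eps / 70) * (2 ^+ (8 * d))%:E)%E) /\
  (forall eps : R, 0 < eps <= 1 ->
     (N_KL d eps <=
        ((5040 * 2 ^+ 32 / eps) `^ ((d%:R - 1) / 2))%:E)%E).
Proof.
split=> [eps eps_gt0|eps eps_itv].
  (* Dividing by the power isolates the infimum, so each Hellinger cover can be treated
     separately. *)
  rewrite -lee_pdivrMr ?exprn_gt0 //; apply: le_ereal_inf_tmp.
  move=> _ [N [q q_cover] <-]; rewrite lee_pdivrMr ?exprn_gt0 //.
  have := @N_KL_le_hellinger2_cover _ _ _ _ _ hd eps_gt0 q_cover.
  by rewrite natrM natrX EFinM.
have /andP[eps_gt0 _] := eps_itv.
case: d hd => // -[|m] _.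
  (* For d = 1 the exponent is 0 and the simplex is one point, so a single center suffices. *)
  rewrite subrr mul0r powRr0.
  have := @N_KL_le_card R 1 eps unit finset.setT (fun=> normalize (fun=> 1)).
  rewrite cardsT card_unit; apply=> [_ _|p pS]; first exact: simplex_normalize.
  exists tt; rewrite ?inE //.
  apply: le_trans (KL_normalize_le _ _ _ _ pS _) _ => //.
  case: pS => _; rewrite !big_ord1 => ->.
  by rewrite subrr expr0n mul0r lee_fin ltW.
apply: le_trans (@N_KL_le_simplex_grid R m.+1 eps isT eps_itv) _.
rewrite lee_fin -[m.+2%:R]natr1 addrK.
(* Already 160^2 = 25600 <= 5040 * 2^4. *)
have K_ge : 160 ^+ 2 <= 5040 * 2 ^+ 32 :> R.
  have : 1 <= 2 ^+ 28 :> R by rewrite exprn_ege1 // ler1n.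
  by rewrite (exprD 2 4 28); lra.
set K := 5040 * 2 ^+ 32 in K_ge *.
have K_ge0 : 0 <= K / eps.
  by rewrite divr_ge0 ?(ltW eps_gt0) // (le_trans _ K_ge) // sqr_ge0.
rewrite [m.+1%:R / 2]mulrC powRrM powR12_sqrt // powR_mulrn ?sqrtr_ge0 //.
apply: lerXn2r; rewrite ?nnegrE ?divr_ge0 ?sqrtr_ge0 //.
rewrite -[160 / _]ger0_norm ?divr_ge0 ?sqrtr_ge0 // -sqrtr_sqr.
apply: ler_wsqrtr; rewrite expr_div_n (sqr_sqrtr (ltW eps_gt0)).
by rewrite ler_pM2r ?invr_gt0.
Qed.
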